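(* Let $Q(E_{10})$ be the root lattice of $E_{10}$, in the coordinates given in the context. For each of the following five cases, consider the assignment of a sign $q(\alpha)\in\{+1,-1\}$ to the roots $\alpha=\epsilon_I-\epsilon_J$ ($I\neq J$) and $\alpha=\epsilon_I+\epsilon_J+\epsilon_K$ ($I<J<K$), where a subset $T\subset\{1,\dots,10\}$ of ''orbifolded directions'' is fixed, together with a sign $s\in\{+1,-1\}$: $$q(\epsilon_I-\epsilon_J)=(-1)^{|\{I,J\}\cap T|},\qquad q(\epsilon_I+\epsilon_J+\epsilon_K)=s\,(-1)^{|\{I,J,K\}\cap T|},$$ and a vector $\tau\in Q(E_{10})$ is given: 1. ($T^5/\mathbb{Z}_2$) $T=\{6,7,8,9,10\}$, $s=-1$, $\tau=(2,2,2,2,2,1,1,1,1,1)$; 2. ($T^8/\mathbb{Z}_2$) $T=\{3,\dots,10\}$, $s=+1$, $\tau=(2,2,1,1,1,1,1,1,1,1)$; 3. (type IA) $T=\{9\}$, $s=-1$, $\tau=(2,2,2,2,2,2,2,2,1,4)$; 4. ($T^9/\mathbb{Z}_2$) $T=\{2,\dots,10\}$, $s=-1$, $\tau=(0,1,1,1,1,1,1,1,1,1)$; 5. ($T^4/\mathbb{Z}_2$) $T=\{7,8,9,10\}$, $s=+1$, $\tau=(2,2,2,2,2,2,1,1,1,3)$ (or any vector obtained from this one by permuting its last four entries). Then in each case $\tau$ is a positive isotropic imaginary root of $E_{10}$ (that is, a positive root with $(\tau|\tau)=0$), the assignment $q$ extends multiplicatively (i.e. $q(\alpha+\beta)=q(\alpha)q(\beta)$)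 to $Q(E_{10})$, and the resulting charge of any root $\beta$ of $E_{10}$ is $$q(\beta)=(-1)^{(\beta|\tau)}.$$
   Context: $E_{10}$ is the Kac–Moody algebra with simple roots $\alpha_{-1},\alpha_0,\dots,\alpha_8$ and simply-laced Dynkin diagram consisting of the chain $\alpha_{-1}-\alpha_0-\alpha_1-\cdots-\alpha_7$ together with one further node $\alpha_8$ joined to $\alpha_5$. Its root lattice is realized as $$Q(E_{10})=\Big\{(n_1,\dots,n_{10})\in\mathbb{Z}^{10}:\ \sum_{i=1}^{10}n_i\in 3\mathbb{Z}\Big\},$$ with bilinear form $(n|m)=\sum_i n_im_i-\frac19\big(\sum_i n_i\big)\big(\sum_i m_i\big)$. Writing $\epsilon_1,\dots,\epsilon_{10}$ for the standard basis vectors of $\mathbb{Z}^{10}$, the simple roots are $\alpha_{j}=\epsilon_{j+2}-\epsilon_{j+3}$ for $j=-1,\dots,7$ and $\alpha_8=\epsilon_8+\epsilon_9+\epsilon_{10}$. The signs on $\epsilon_I-\epsilon_J$ and on $\epsilon_I+\epsilon_J+\epsilon_K$ encode the $\mathbb{Z}_2$-charges of the metric components $g_{IJ}$ and of the 3-form components $C_{IJK}$ of eleven-dimensional supergravity, and $\tau$ is the root associated with the branes of the twisted sector (M5-branes, M2-branes, D8-branes, Kaluza–Klein particles, Kaluza–Klein monopoles, respectively). *)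

(* Defs.v *)
From HB Require Import structures.
From mathcomp Require Import all_boot all_order all_algebra.

Set Implicit Arguments.
Unset Strict Implicit.
Unset Printing Implicit Defensive.

Import Order.TTheory GRing.Theory Num.Theory.
Local Open Scope ring_scope.

(** The Kac-Moody algebra g(A) of a symmetrizable generalized Cartan matrix A
    with det A != 0, over a field K of characteristic 0, given by the
    Chevalley-Serre presentation: Lie words in e_i, f_i, h_i modulo the least
    congruence [km_eq A] containing the Lie algebra axioms and the
    Chevalley-Serre relations.  Since A is nonsingular, the Cartan subalgebra
    is spanned by the h_i and no extra derivations are needed. *)

Inductive lie_term (K : Type) (n : nat) : Type :=
| LZero
| LAdd (x y : lie_term K n)
| LOpp (x : lie_term K n)
| LScale (a : K) (x : lie_term K n)
| LBr (x y : lie_term K n)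
| LE (i : 'I_n)
| LF (i : 'I_n)
| LH (i : 'I_n).

Arguments LZero {K n}.
Arguments LE {K n} i.
Arguments LF {K n} i.
Arguments LH {K n} i.

Inductive km_eq (K : fieldType) (n : nat) (A : 'M[int]_n) :
    lie_term K n -> lie_term K n -> Prop :=
| km_refl x : km_eq A x x
| km_sym x y : km_eq A x y -> km_eq A y x
| km_trans x y z : km_eq A x y -> km_eq A y z -> km_eq A x z
| km_congD x x' y y' :
    km_eq A x x' -> km_eq A y y' -> km_eq A (LAdd x y) (LAdd x' y')
| km_congN x x' : km_eq A x x' -> km_eq A (LOpp x) (LOpp x')
| km_congZ a x x' : km_eq A x x' -> km_eq A (LScale a x) (LScale a x')
| km_congB x x' y y' :
    km_eq A x x' -> km_eq A y y' -> km_eq A (LBr x y) (LBr x' y')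
| km_addA x y z : km_eq A (LAdd x (LAdd y z)) (LAdd (LAdd x y) z)
| km_addC x y : km_eq A (LAdd x y) (LAdd y x)
| km_add0 x : km_eq A (LAdd LZero x) x
| km_addN x : km_eq A (LAdd (LOpp x) x) LZero
| km_scaleA a b x : km_eq A (LScale a (LScale b x)) (LScale (a * b) x)
| km_scale1 x : km_eq A (LScale 1 x) x
| km_scaleDr a x y :
    km_eq A (LScale a (LAdd x y)) (LAdd (LScale a x) (LScale a y))
| km_scaleDl a b x :
    km_eq A (LScale (a + b) x) (LAdd (LScale a x) (LScale b x))
| km_brDl x y z : km_eq A (LBr (LAdd x y) z) (LAdd (LBr x z) (LBr y z))
| km_brDr x y z : km_eq A (LBr x (LAdd y z)) (LAdd (LBr x y) (LBr x z))
| km_brZl a x y : km_eq A (LBr (LScale a x) y) (LScale a (LBr x y))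
| km_brZr a x y : km_eq A (LBr x (LScale a y)) (LScale a (LBr x y))
| km_brxx x : km_eq A (LBr x x) LZero
| km_jacobi x y z :
    km_eq A (LAdd (LBr x (LBr y z)) (LAdd (LBr y (LBr z x)) (LBr z (LBr x y))))
            LZero
| km_hh i j : km_eq A (LBr (LH i) (LH j)) LZero
| km_ef i j : km_eq A (LBr (LE i) (LF j)) (if i == j then LH i else LZero)
| km_he i j : km_eq A (LBr (LH i) (LE j)) (LScale (A i j)%:~R (LE j))
| km_hf i j : km_eq A (LBr (LH i) (LF j)) (LScale (- (A i j)%:~R) (LF j))
| km_serre_e i j : i != j ->
    km_eq A (iter `|1 - A i j|%N (LBr (LE i)) (LE j)) LZero
| km_serre_f i j : i != j ->
    km_eq A (iter `|1 - A i j|%N (LBr (LF i)) (LF j)) LZero.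

(** [km_root K A c]: \sum_j c_j alpha_j is a root of g(A), where
    alpha_j(h_i) = A i j. *)
Definition km_root (K : fieldType) (n : nat) (A : 'M[int]_n)
    (c : 'I_n -> int) : Prop :=
  (exists j, c j != 0) /\
  exists x : lie_term K n,
    ~ km_eq A x LZero /\
    forall i, km_eq A (LBr (LH i) x) (LScale (\sum_j c j * A i j)%:~R x).

(** Index i : 'I_10 stands for the node alpha_{i-1}; so the branching node
    alpha_5 has index 6 and the extra node alpha_8 has index 9. *)
Definition e10_edge (i j : 'I_10) : bool :=
  ((j == i.+1 :> nat) && (j < 9)%N) || ((i == 6 :> nat) && (j == 9 :> nat)).

Definition e10_cartan : 'M[int]_10 :=
  \matrix_(i, j) (if i == j then 2
                  else if e10_edge i j || e10_edge j i then -1 else 0).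

(** Coordinates are numbered from 0: [eps i] is epsilon_{i+1}. *)
Definition eps (i : 'I_10) : 'rV[int]_10 := delta_mx 0 i.

Definition coord_sum (n : 'rV[int]_10) : int := \sum_i n 0 i.

Definition e10_lattice : {pred 'rV[int]_10} :=
  [pred n | (3 %| coord_sum n)%Z].

Definition e10_form (n m : 'rV[int]_10) : rat :=
  (\sum_i n 0 i * m 0 i)%:~R - 9^-1 * (coord_sum n)%:~R * (coord_sum m)%:~R.

Definition simple_root (i : 'I_10) : 'rV[int]_10 :=
  if (i < 9)%N then eps i - eps (inord i.+1)
  else eps (inord 7) + eps (inord 8) + eps (inord 9).

Lemma simple_root_gram (i j : 'I_10) :
  e10_form (simple_root i) (simple_root j) = (e10_cartan i j)%:~R.
Proof.
pose r (a k : nat) : int := if (a < 9)%N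
  then (k == a)%:R - (k == a.+1)%:R
  else (k == 7)%:R + (k == 8)%:R + (k == 9)%:R.
have rE (a k : 'I_10) : simple_root a 0 k = r a k.
  rewrite /simple_root /r; case: ifP => a9;
    by rewrite !mxE -!val_eqE /= !inordK ?ltnS.
pose S (f : nat -> int) : int := foldr (fun k x => f k + x) 0 (iota 0 10).
have SE (f : nat -> int) : \sum_(k < 10) f k = S f.
  by rewrite -(big_mkord xpredT) unlock.
pose e (a b : nat) := ((b == a.+1) && (b < 9)%N) || ((a == 6) && (b == 9)).
pose c (a b : nat) : int :=
  if a == b then 2 else if e a b || e b a then -1 else 0.
have chk : all (fun a => all (fun b => 9 * S (fun k => r a k * r b k)
    - S (r a) * S (r b) == 9 * c a b) (iota 0 10)) (iota 0 10).
  by vm_compute.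
have ij (a : 'I_10) : (a : nat) \in iota 0 10 by rewrite mem_iota /= ltn_ord.
have /eqP h := allP (allP chk _ (ij i)) _ (ij j).
rewrite /e10_form /coord_sum mxE.
under eq_bigr do rewrite !rE.
under [X in _ * X%:~R * _]eq_bigr do rewrite rE.
under [X in _ - _ * X%:~R]eq_bigr do rewrite rE.
rewrite (SE (fun k => r i k * r j k)) !SE -mulrA -intrM.
apply: (@mulfI _ (9 : rat)) => //.
rewrite mulrBr mulrA mulfV // mul1r -[9]/(9%:~R) -!intrM -rmorphB /= h.
by rewrite -val_eqE.
Qed.

Definition e10_root (K : fieldType) (beta : 'rV[int]_10) : Prop :=
  exists2 c : 'I_10 -> int,
    beta = \sum_j c j *: simple_root j & km_root K e10_cartan c.

Definition e10_positive_root (K : fieldType) (beta : 'rV[int]_10) : Prop :=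
  exists2 c : 'I_10 -> int,
    beta = \sum_j c j *: simple_root j &
    km_root K e10_cartan c /\ forall j, 0 <= c j.

(** [multiplicative_extension T s q]: q is a multiplicative {+1,-1}-valued map
    on Q(E10) with the prescribed values; values of q outside Q(E10) are
    irrelevant. *)
Record multiplicative_extension (T : {set 'I_10}) (s : int)
    (q : 'rV[int]_10 -> int) : Prop := MultiplicativeExtension {
  ext_sign : {in e10_lattice, forall a, q a = 1 \/ q a = -1};
  ext_mul : {in e10_lattice &, forall a b, q (a + b) = q a * q b};
  ext_metric : forall I J : 'I_10, I != J ->
    q (eps I - eps J) = (-1) ^+ #|[set I; J] :&: T|;
  ext_form : forall I J L : 'I_10, (I < J)%N -> (J < L)%N ->
    q (eps I + eps J + eps L) = s * (-1) ^+ #|[set I; J; L] :&: T|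
}.

(** Directions are listed with labels 1, ..., 10. *)
Definition directions (l : seq nat) : {set 'I_10} :=
  [set i : 'I_10 | i.+1 \in l].

Definition vec10 (l : seq int) : 'rV[int]_10 := \row_i nth 0 l i.

Inductive orbifold_data : {set 'I_10} -> int -> 'rV[int]_10 -> Prop :=
| Orb_T5 : orbifold_data (directions [:: 6; 7; 8; 9; 10]%N) (-1)
    (vec10 [:: 2; 2; 2; 2; 2; 1; 1; 1; 1; 1])
| Orb_T8 : orbifold_data (directions [:: 3; 4; 5; 6; 7; 8; 9; 10]%N) 1
    (vec10 [:: 2; 2; 1; 1; 1; 1; 1; 1; 1; 1])
| Orb_IA : orbifold_data (directions [:: 9]%N) (-1)
    (vec10 [:: 2; 2; 2; 2; 2; 2; 2; 2; 1; 4])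
| Orb_T9 : orbifold_data (directions [:: 2; 3; 4; 5; 6; 7; 8; 9; 10]%N) (-1)
    (vec10 [:: 0; 1; 1; 1; 1; 1; 1; 1; 1; 1])
| Orb_T4 (l : seq int) : perm_eq l [:: 1; 1; 1; 3] ->
    orbifold_data (directions [:: 7; 8; 9; 10]%N) 1
      (vec10 ([:: 2; 2; 2; 2; 2; 2] ++ l)).

(* Main.v *)
Require Import Defs.
From HB Require Import structures.
From mathcomp Require Import all_boot all_order all_algebra.
From mathcomp Require Import boolp functions.
From mathcomp Require Import zify ring.

(** That tau is a root rests on strings through roots: if x <> 0 has weight c in
    a Kac-Moody algebra and k <= - <c, alpha_i^vee>, then (ad e_i)^k x <> 0,
    because ad f_i is locally nilpotent.  Every null root tau is reached in this
    way: from a simple root through real roots up to the highest root of E8, by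
    one more string to the null root (0, 1, ..., 1) of E9, and then by simple
    reflections.  The induction starts from e_i <> 0, which needs a nonzero
    representation of the algebra: the irreducible module of lowest weight
    (1, ..., 1), inside the module coinduced from the f_i.

    For the charges, q and a |-> (-1)^(a|tau) are both multiplicative on the
    lattice, so they only have to be compared on the simple roots; there they
    agree because i is in T exactly when tau_i is odd, and s = (-1)^m where 3 m
    is the sum of the tau_i. *)

Set Implicit Arguments.
Unset Strict Implicit.
Unset Printing Implicit Defensive.

Import Order.TTheory GRing.Theory Num.Theory.
Local Open Scope ring_scope.

(** * Representations of sl2 *)

Section Sl2Strings.
Variables (K : fieldType) (V : lmodType K) (e f h : {linear V -> V}).
(** The relations are assumed only on a stable class [P]. They will be applied to commutators acting
    on arbitrary functions, where they hold for the linear ones. *)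
Variable P : V -> Prop.
Hypothesis Pf : forall v, P v -> P (f v).
Hypothesis ef : forall v, P v -> e (f v) = f (e v) + h v.
Hypothesis hf : forall v, P v -> h (f v) = f (h v) - 2 *: f v.

Lemma sl2_iter_closed k v : P v -> P (iter k f v).
Proof. by move=> Pv; elim: k => //= k; apply: Pf. Qed.

Lemma sl2_iter_weight m k v : P v -> h v = m *: v ->
  h (iter k f v) = (m - 2 * k%:R) *: iter k f v.
Proof.
move=> Pv hv; elim: k => [|k IHk] /=; first by rewrite mulr0 subr0.
rewrite hf ?IHk; last exact: sl2_iter_closed.
by rewrite linearZ /= -scalerBl; congr (_ *: _); ring.
Qed.

Lemma sl2_iter_raise m k v : P v -> h v = m *: v ->
  e (iter k.+1 f v) =
  iter k.+1 f (e v) + (k.+1%:R * (m - k%:R)) *: iter k f v.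
Proof.
move=> Pv hv; elim: k => [|k IHk]; first by rewrite /= ef // hv subr0 mul1r.
rewrite iterS ef ?IHk; last exact: sl2_iter_closed.
rewrite linearD linearZ (sl2_iter_weight _ Pv hv) -!iterS -addrA -scalerDl.
congr (_ + _ *: _); ring.
Qed.

End Sl2Strings.

Section LocallyNilpotent.
Variables (K : fieldType) (charK : [pchar K] =i pred0).
Variables (V : lmodType K) (e f h : {linear V -> V}).
Hypothesis ef : forall v, e (f v) = f (e v) + h v.
Hypothesis he : forall v, h (e v) = e (h v) + 2 *: e v.
Hypothesis hf : forall v, h (f v) = f (h v) - 2 *: f v.

Let raise m k v (hv : h v = m *: v) :=
  @sl2_iter_raise K V e f h (fun=> True) (fun _ _ => I)
    (fun v _ => ef v) (fun v _ => hf v) m k v I hv.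

(** Induction on the nilpotency order [N]. The vector [e v] has weight n + 2, and the raising
    identity gives f^(n+2) (e v) = 0, so [e v = 0]. Then [v] is a highest weight vector, and
    applying [e] to f^n v = 0 repeatedly climbs back to [v]. *)
Lemma sl2_lower_injective N n v :
  iter N e v = 0 -> h v = n%:R *: v -> iter n f v = 0 -> v = 0.
Proof.
elim: N n v => [|N IHN] n v // eNv hv fnv.
have fS j : (n <= j)%N -> iter j f v = 0.
  move=> /subnK <-; rewrite iterD fnv.
  by elim: (j - n)%N => //= {}j ->; rewrite linear0.
have ev0 : e v = 0.
  apply: (IHN n.+2); rewrite -?iterSr //.
    by rewrite he hv linearZ -scalerDl -natrD addn2.
  have := raise n.+1 hv; rewrite !fS ?leqW // scaler0 addr0 linear0.
  by move=> <-.
have fkv k : (k <= n)%N -> iter (n - k) f v = 0.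
  elim: k => [|k IHk] ltkn; first by rewrite subn0.
  (* The scalar in front of f^(n-k-1) v is (n - k) (k + 1), nonzero in characteristic 0. *)
  have := raise (n - k.+1) hv; rewrite ev0 subnSK // IHk; last exact: ltnW.
  rewrite linear0 [X in _ = X + _](_ : _ = 0) ?add0r; last first.
    by elim: (n - k)%N => //= j ->; rewrite linear0.
  move/esym/eqP; rewrite scaler_eq0 -natrB ?leq_subr // subKn //.
  rewrite -natrM ((pcharf0P _).1 charK) muln_eq0 subn_eq0 leqNgt ltkn /=.
  by move/eqP.
by rewrite -(fkv n) // subnn.
Qed.

End LocallyNilpotent.

(** * Commutators as operators on functions *)

Section Commutators.
Variables (K : fieldType) (V : lmodType K).

(** Taken on all functions, which form a module pointwise, so that the sl2 lemmas apply to [ad x] as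
    an operator on it. *)
Definition ad (x X : V -> V) : V -> V := fun a => x (X a) - X (x a).

Variable x : {linear V -> V}.

Lemma ad_is_linear : linear (ad x).
Proof.
move=> c X Y; apply/funext => a.
suff : x (c *: X a + Y a) - (c *: X (x a) + Y (x a)) =
  c *: (x (X a) - X (x a)) + (x (Y a) - Y (x a)) by [].
by rewrite linearP scalerBr opprD addrACA.
Qed.

HB.instance Definition _ :=
  GRing.isLinear.Build K (V -> V) (V -> V) _ (ad x) ad_is_linear.

Lemma ad_linear (X : V -> V) : linear X -> linear (ad x X).
Proof.
by move=> lX c a b; rewrite /ad lX !linearP lX scalerBr opprD addrACA.
Qed.

End Commutators.

(** * The Serre relations *)

(** The Jacobi identity, with [c] the commutator of [a] and [b]. *)
Lemma ad_commute (K : fieldType) (V : lmodType K) (a b : {linear V -> V})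
    (c X : V -> V) : zmod_morphism X -> (forall v, a (b v) = b (a v) + c v) ->
  ad a (ad b X) = ad b (ad a X) + ad c X.
Proof.
move=> XB abE; apply/funext => v.
suff : a (b (X v) - X (b v)) - (b (X (a v)) - X (b (a v))) =
  b (a (X v) - X (a v)) - (a (X (b v)) - X (a (b v))) + (c (X v) - X (c v)).
  by [].
have XD u w : X (u + w) = X u + X w.
  by apply/eqP; rewrite -subr_eq -XB addrK.
rewrite !linearB !abE XD /= !opprK [in RHS]addrACA.
by rewrite [- _ + (_ + _)]addrA addrK [in RHS](addrAC (b _)) [RHS]addrACA.
Qed.

Lemma ad_scale (K : fieldType) (V : lmodType K) c (b X : V -> V) :
  scalable X -> ad (fun v => c *: b v) X = c *: ad b X.
Proof.
move=> XZ; apply/funext => v.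
suff : c *: b (X v) - X (c *: b v) = c *: (b (X v) - X (b v)) by [].
by rewrite XZ scalerBr.
Qed.

Lemma ad_zero (K : fieldType) (V : lmodType K) (X : V -> V) :
  X 0 = 0 -> ad (fun=> 0) X = 0.
Proof. by move=> X0; apply/funext => v; rewrite /ad X0 subr0. Qed.

Section SerreRelations.
Variables (K : fieldType) (V : lmodType K) (n : nat) (A : 'M[int]_n).
Hypothesis A_diag : forall i, A i i = 2.
Hypothesis A_off : forall i j, i != j -> A i j <= 0.
Hypothesis A_zero : forall i j, A i j = 0 -> A j i = 0.
Variables x y h : 'I_n -> {linear V -> V}.
Hypothesis xy : forall i j v,
  x i (y j v) = y j (x i v) + (if i == j then h i v else 0).
Hypothesis hy : forall i j v,
  h i (y j v) = y j (h i v) - (A i j)%:~R *: y j v.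

Let ad_xy i j (X : V -> V) : linear X ->
  ad (x i) (ad (y j) X) =
  ad (y j) (ad (x i) X) + (if i == j then ad (h i) X else 0).
Proof.
move=> lX; have XB := zmod_morphism_linear lX.
rewrite (ad_commute XB (xy i j)); congr (_ + _); case: eqP => // _.
by apply: ad_zero; have := XB 0 0; rewrite !subrr.
Qed.

Let ad_hy i j (X : V -> V) : linear X ->
  ad (h i) (ad (y j) X) =
  ad (y j) (ad (h i) X) - (A i j)%:~R *: ad (y j) X.
Proof.
move=> lX; have XB := zmod_morphism_linear lX.
rewrite (@ad_commute _ _ (h i) (y j) (fun v => - (A i j)%:~R *: y j v)) //.
  by rewrite ad_scale ?scaleNr //; apply: scalable_linear.
by move=> v; rewrite scaleNr hy.
Qed.

Let ad_hyE i j : ad (h i) (y j) = - (A i j)%:~R *: (y j : V -> V).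
Proof.
apply/funext => v; rewrite /ad hy addrAC subrr add0r.
by rewrite -[RHS]/(- (A i j)%:~R *: y j v) scaleNr.
Qed.

(* Stated for abstract x, y, h so as to apply both to (e, f, h) and to
   (f, e, -h). *)
Lemma ad_serre_eq0 i j k : i != j ->
  ad (x k) (iter `|1 - A i j|%N (ad (y i)) (y j)) = 0.
Proof.
move=> neq_ij; have yl := linearP (y j).
have [p Ap] : exists p : nat, A i j = - p%:Z.
  by exists `|A i j|%N; have := A_off neq_ij; lia.
have -> : `|1 - A i j|%N = p.+1 by lia.
have [<-{k}|neq_ik] := eqVneq i k.
  (* Here [y j] is killed by [ad (x i)] and has weight p, so the scalar (p + 1) (p - p) in the
     raising identity vanishes. *)
  have := @sl2_iter_raise K (V -> V) (ad (x i)) (ad (y i)) (ad (h i))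
    (fun X => linear X) (ad_linear (y i)).
  move=> /(_ _ _ p%:R p (y j) yl) ->.
  - rewrite subrr mulr0 scale0r addr0.
    rewrite [X in iter _ _ X](_ : _ = 0); last first.
      by apply/funext => v /=; rewrite /ad xy (negPf neq_ij) addr0 subrr.
    by elim: p.+1 => //= q ->; rewrite linear0.
  - by move=> X lX; have := ad_xy i i lX; rewrite eqxx.
  - by move=> X lX; have := ad_hy i i lX; rewrite A_diag.
  - by have := ad_hyE i j; rewrite Ap rmorphN opprK.
(* For k different from i, [ad (x k)] commutes with [ad (y i)] and can act directly on [y j]. *)
have xS q : ad (x k) (iter q (ad (y i)) (y j)) =
            iter q (ad (y i)) (ad (x k) (y j)).
  elim: q => //= q <-; rewrite ad_xy ?(negPf neq_ik) ?addr0 //.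
    by rewrite eq_sym (negPf neq_ik) addr0.
  by elim: q => //= q; apply: ad_linear.
rewrite xS; have [eq_jk|neq_jk] := eqVneq k j; last first.
  rewrite [X in iter _ _ X](_ : _ = 0); last first.
    by apply/funext => v /=; rewrite /ad xy (negPf neq_jk) addr0 subrr.
  by elim: p.+1 => //= q ->; rewrite linear0.
have -> : ad (x k) (y j) = h j.
  by apply/funext => v; rewrite /ad xy eq_jk eqxx addrAC subrr add0r.
have yh : ad (y i) (h j) = (A j i)%:~R *: (y i : V -> V).
  apply/funext => v; rewrite /ad hy opprB addrCA subrr addr0.
  by [].
have yy : ad (y i) (y i) = 0 by apply/funext => v; apply: subrr.
(* The first commutator turns [h j] into a multiple of [y i]. If p = 0 the multiple is zero because
   [A i j = 0]; otherwise the next commutator is that of [y i] with itself. *)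
case: p Ap {xS} => [|p] Ap; first by rewrite /= yh A_zero ?scale0r.
rewrite !iterSr yh linearZ /= yy scaler0.
by elim: {Ap}p => //= q ->; rewrite linear0.
Qed.

End SerreRelations.

(** * A lowest weight module *)

Section LowestWeightModule.
Variables (K : fieldType) (n : nat) (A : 'M[int]_n).
(* A vector v is encoded by the function sending the word [:: i_1; ...; i_r] to
   the vacuum coefficient of f_{i_r} ... f_{i_1} v.  This determines the action
   of f_i, and the action of e_i is then forced by [e_i, f_j] = delta_ij h_i and
   by e_i v having no vacuum coefficient. *)
Local Notation C := (seq 'I_n -> K^o).

(** The h_i-eigenvalue of a vector that the lowerings along [w] bring to the vacuum: the vacuum has
    weight 1, and each f_j subtracts [A i j]. *)
Definition weight_at (i : 'I_n) (w : seq 'I_n) : int :=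
  1 + \sum_(j <- w) A i j.

Definition lower (i : 'I_n) (a : C) : C := fun w => a (i :: w).

Definition cartan (i : 'I_n) (a : C) : C := fun w => (weight_at i w)%:~R * a w.

Fixpoint raise_at (i : 'I_n) (w : seq 'I_n) (a : C) : K^o :=
  if w is j :: w' then
    raise_at i w' (lower j a) - (if i == j then cartan i a w' else 0)
  else 0.

Definition raise (i : 'I_n) (a : C) : C := raise_at i ^~ a.

Lemma lower_is_linear i : linear (lower i). Proof. by []. Qed.
HB.instance Definition _ i :=
  GRing.isLinear.Build K C C _ (lower i) (lower_is_linear i).

Lemma cartan_is_linear i : linear (cartan i).
Proof.
move=> c a b; apply/funext => w.
suff : (weight_at i w)%:~R * (c * a w + b w) =
  c * ((weight_at i w)%:~R * a w) + (weight_at i w)%:~R * b w by [].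
by rewrite mulrDr mulrCA.
Qed.
HB.instance Definition _ i :=
  GRing.isLinear.Build K C C _ (cartan i) (cartan_is_linear i).

Lemma raise_is_linear i : linear (raise i).
Proof.
move=> c a b; apply/funext => w.
suff : raise_at i w (c *: a + b) = c * raise_at i w a + raise_at i w b by [].
elim: w a b => [|j w IHw] a b /=; first by rewrite mulr0 addr0.
rewrite linearP IHw; case: eqP => _; last by rewrite !subr0.
rewrite linearP -[(_ + _) w]/(c * cartan i a w + cartan i b w).
by ring.
Qed.
HB.instance Definition _ i :=
  GRing.isLinear.Build K C C _ (raise i) (raise_is_linear i).

Lemma raise_lower i j a :
  raise i (lower j a) =
  lower j (raise i a) + (if i == j then cartan i a else 0).
Proof.
apply/funext => w.
rewrite -[RHS]/(lower j (raise i a) w + (if i == j then cartan i a else 0) w).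
rewrite /lower /raise /=; case: eqP => _; last by rewrite subr0 addr0.
by rewrite subrK.
Qed.

Lemma cartan_lower i j a :
  cartan i (lower j a) = lower j (cartan i a) - (A i j)%:~R *: lower j a.
Proof.
apply/funext => w.
suff : (weight_at i w)%:~R * a (j :: w) =
  (weight_at i (j :: w))%:~R * a (j :: w) - (A i j)%:~R * a (j :: w) by [].
by rewrite /weight_at big_cons -mulrBl -rmorphB /= addrCA addrAC subrr add0r.
Qed.

(** Since [raise] is determined by its commutators with [lower], its weight is found by induction on
    the word. *)
Lemma cartan_raise i j a :
  cartan i (raise j a) = raise j (cartan i a) + (A i j)%:~R *: raise j a.
Proof.
apply/funext => w.
suff : (weight_at i w)%:~R * raise_at j w a =
  raise_at j w (cartan i a) + (A i j)%:~R * raise_at j w a by [].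
elim: w a => [|k w IHw] a /=; first by rewrite !mulr0 addr0.
have -> : lower k (cartan i a) =
    (A i k)%:~R *: lower k a + cartan i (lower k a).
  by rewrite cartan_lower addrC subrK.
have -> c b b' : raise_at j w (c *: b + b') =
    c * raise_at j w b + raise_at j w b'.
  by have /(congr1 (@^~ w)) := linearP (raise j) c b b'.
have wE : weight_at i (k :: w) = A i k + weight_at i w.
  by rewrite /weight_at big_cons addrCA.
rewrite wE rmorphD /= mulrDl mulrBr mulrBr IHw.
case: eqP => [<-|_]; rewrite /cartan; ring.
Qed.

Lemma cartan_comm i j a : cartan i (cartan j a) = cartan j (cartan i a).
Proof. by apply/funext => w; rewrite /cartan mulrCA. Qed.

Definition vacuum : C := fun w => (w == [::])%:R.

(* The Serre relations in the f_i fail on C, but hold on the submodule generated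
   by the vacuum: they kill the vacuum and commute with every e_k. *)
Inductive generated : C -> Prop :=
| generated_vacuum : generated vacuum
| generated0 : generated 0
| generatedD a b : generated a -> generated b -> generated (a + b)
| generatedZ c a : generated a -> generated (c *: a)
| generated_raise i a : generated a -> generated (raise i a).

Lemma lower_vacuum i : lower i vacuum = 0. Proof. exact/funext. Qed.

Lemma cartan_vacuum i : cartan i vacuum = vacuum.
Proof.
apply/funext => -[|j w]; rewrite /cartan /vacuum /= ?mulr0 //.
by rewrite /weight_at big_nil mulr1.
Qed.

Lemma generated_cartan i a : generated a -> generated (cartan i a).
Proof.
elim=> [||b c _ IHb _ IHc|c b _ IHb|j b gb IHb].
- by rewrite cartan_vacuum; apply: generated_vacuum.
- by rewrite linear0; apply: generated0.
- by rewrite linearD; apply: generatedD.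
- by rewrite linearZ; apply: generatedZ.
- rewrite cartan_raise; apply: generatedD; first exact: generated_raise.
  by apply: generatedZ; apply: generated_raise.
Qed.

(** Moving [lower i] past each [raise j] costs at most a Cartan term, and at the end it kills the
    vacuum. *)
Lemma generated_lower i a : generated a -> generated (lower i a).
Proof.
elim=> [||b c _ IHb _ IHc|c b _ IHb|j b gb IHb].
- by rewrite lower_vacuum; apply: generated0.
- by rewrite linear0; apply: generated0.
- by rewrite linearD; apply: generatedD.
- by rewrite linearZ; apply: generatedZ.
have -> : lower i (raise j b) =
    raise j (lower i b) + -1 *: (if j == i then cartan j b else 0).
  by rewrite raise_lower scaleN1r addrK.
apply: generatedD; first exact: generated_raise.
apply: generatedZ.
by case: eqP => _; [apply: generated_cartan|apply: generated0].
Qed.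

Fixpoint action (t : lie_term K n) : C -> C :=
  match t with
  | LZero => fun=> 0
  | LAdd t u => fun a => action t a + action u a
  | LOpp t => fun a => - action t a
  | LScale c t => fun a => c *: action t a
  | LBr t u => ad (action t) (action u)
  | LE i => raise i
  | LF i => lower i
  | LH i => cartan i
  end.

Lemma action_linear t : linear (action t).
Proof.
elim: t => [|t IHt u IHu|t IHt|d t IHt|t IHt u IHu|i|i|i] c a b /=;
  try exact: linearP.
- by rewrite scaler0 addr0.
- by rewrite IHt IHu scalerDr addrACA.
- by rewrite IHt opprD scalerN.
- by rewrite IHt scalerDr !scalerA mulrC.
- by rewrite /ad IHu IHt IHt IHu scalerBr opprD addrACA.
Qed.

Lemma action_generated t a : generated a -> generated (action t a).
Proof.
elim: t a => [|t IHt u IHu|t IHt|d t IHt|t IHt u IHu|i|i|i] a ga /=.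
- exact: generated0.
- by apply: generatedD; [apply: IHt|apply: IHu].
- by rewrite -scaleN1r; apply/generatedZ/IHt.
- exact/generatedZ/IHt.
- rewrite /ad -scaleN1r; apply: generatedD; first exact/IHt/IHu.
  exact/generatedZ/IHu/IHt.
- exact: generated_raise.
- exact: generated_lower.
- exact: generated_cartan.
Qed.

Hypothesis A_diag : forall i, A i i = 2.
Hypothesis A_off : forall i j, i != j -> A i j <= 0.
Hypothesis A_zero : forall i j, A i j = 0 -> A j i = 0.

Lemma action_serre_f i j a : i != j -> generated a ->
  action (iter `|1 - A i j|%N (LBr (LF i)) (LF j)) a = 0.
Proof.
move=> neq_ij; set S := iter _ _ _.
have S_raise k b : raise k (action S b) = action S (raise k b).
  have := ad_serre_eq0 A_diag A_off A_zero raise_lower cartan_lower k neq_ij.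
  have -> : iter `|1 - A i j|%N (ad (lower i)) (lower j) = action S.
    by rewrite /S; elim: `|_|%N => //= q ->.
  by move/(congr1 (@^~ b)) => /subr0_eq.
have SL := action_linear S.
elim=> [||b c _ IHb _ IHc|c b _ IHb|k b gb IHb].
- rewrite /S; elim: `|_|%N => [|q IHq] /=; first exact: lower_vacuum.
  rewrite /ad IHq lower_vacuum linear0 sub0r.
  have := zmod_morphism_linear (action_linear (iter q (LBr (LF i)) (LF j))) 0 0.
  by rewrite !subrr => ->; rewrite oppr0.
- by have := zmod_morphism_linear SL 0 0; rewrite !subrr.
- by rewrite -[b]scale1r SL IHb IHc scaler0 addr0.
- by rewrite (scalable_linear SL) IHb; apply: scaler0.
- by rewrite -S_raise IHb linear0.
Qed.

(** The Serre element commutes with every [lower k] and its values have no vacuum coefficient. As a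
    vector is determined by the vacuum coefficients of its lowerings, induction on the word gives
    zero on the whole of [C]. *)
Lemma action_serre_e i j a : i != j ->
  action (iter `|1 - A i j|%N (LBr (LE i)) (LE j)) a = 0.
Proof.
move=> neq_ij; set S := iter _ _ _.
have S_lower k b : lower k (action S b) = action S (lower k b).
  suff : ad (lower k) (iter `|1 - A i j|%N (ad (raise i)) (raise j)) = 0.
    have -> : iter `|1 - A i j|%N (ad (raise i)) (raise j) = action S.
      by rewrite /S; elim: `|_|%N => //= q ->.
    by move/(congr1 (@^~ b)) => /subr0_eq.
  (* The roles are exchanged: [lower], [raise] and minus [cartan] satisfy the same relations. *)
  apply: (@ad_serre_eq0 _ _ _ A A_diag A_off A_zero lower raise
    (fun i => -1 \*: cartan i)) => // [k' l c|k' l c].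
  - rewrite /= raise_lower eq_sym.
    by case: eqP => [->|_]; rewrite ?addr0 //= scaleN1r addrK.
  - suff : -1 *: cartan k' (raise l c) =
      raise l (-1 *: cartan k' c) - (A k' l)%:~R *: raise l c by [].
    by rewrite !scaleN1r cartan_raise linearN opprD.
apply/funext => w; elim: w a => [|k w IHw] a.
  rewrite /S; elim: `|_|%N a => [|q IHq] a //=.
  rewrite /ad -[LHS]/(raise i _ [::] - action _ _ [::]) IHq /=.
  by rewrite subr0.
by rewrite -[LHS]/(lower k (action S a) w) S_lower IHw.
Qed.

(** The generated submodule is a representation of the presented algebra. Its stability under
    [action] is what lets congruence pass through brackets. *)
Lemma action_km_eq t u a :
  km_eq A t u -> generated a -> action t a = action u a.
Proof.
move=> tu; elim: tu a => {t u} //=.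
- by move=> t u _ IH a ga; rewrite IH.
- by move=> t u v _ IHtu _ IHuv a ga; rewrite IHtu ?IHuv.
- by move=> t t' u u' _ IHt _ IHu a ga; rewrite IHt ?IHu.
- by move=> t t' _ IHt a ga; rewrite IHt.
- by move=> c t t' _ IHt a ga; rewrite IHt.
- move=> t t' u u' _ IHt _ IHu a ga.
  rewrite /ad (IHu a) // (IHt a) // IHt ?IHu //; exact: action_generated.
- by move=> t u v a ga; rewrite addrA.
- by move=> t u a ga; rewrite addrC.
- by move=> t a ga; rewrite add0r.
- by move=> t a ga; rewrite addNr.
- by move=> c d t a ga; rewrite scalerA.
- by move=> t a ga; rewrite scale1r.
- by move=> c t u a ga; rewrite scalerDr.
- by move=> c d t a ga; rewrite scalerDl.
- move=> t u v a ga; have tB := zmod_morphism_linear (action_linear v).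
  rewrite /ad; have -> w w' : action v (w + w') = action v w + action v w'.
    by rewrite -{2}[w](addrK w') tB subrK.
  by rewrite opprD addrACA.
- move=> t u v a ga; have tB := zmod_morphism_linear (action_linear t).
  rewrite /ad; have -> w w' : action t (w + w') = action t w + action t w'.
    by rewrite -{2}[w](addrK w') tB subrK.
  by rewrite opprD addrACA.
- move=> c t u a ga; rewrite /ad (scalable_linear (action_linear u)).
  by rewrite scalerBr.
- move=> c t u a ga; rewrite /ad (scalable_linear (action_linear t)).
  by rewrite scalerBr.
- by move=> t a ga; rewrite /ad subrr.
- move=> t u v a ga.
  have tB := zmod_morphism_linear (action_linear t).
  have uB := zmod_morphism_linear (action_linear u).
  have vB := zmod_morphism_linear (action_linear v).
  rewrite /ad !tB !uB !vB !opprB.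
  (* In this order the six differences telescope. *)
  rewrite [LHS](AC (2 * (2 * 2)) (1 * 4 * 5 * 2 * 3 * 6)) /=.
  by rewrite !addrA !subrK subrr.
- by move=> i j a ga; rewrite /ad cartan_comm subrr.
- move=> i j a ga; rewrite /ad raise_lower addrAC subrr add0r.
  by case: eqP.
- by move=> i j a ga; rewrite /ad cartan_raise addrAC subrr add0r.
- by move=> i j a ga; rewrite /ad cartan_lower addrAC subrr add0r scaleNr.
- by move=> i j neq_ij a ga; apply: action_serre_e.
- by move=> i j neq_ij a ga; apply: action_serre_f.
Qed.

End LowestWeightModule.

(** * The Kac-Moody algebra as a quotient *)

(** Classical equality and choice on terms, as the quotient construction requires. *)
HB.instance Definition _ (K : Type) (n : nat) := gen_eqMixin (lie_term K n).
HB.instance Definition _ (K : Type) (n : nat) :=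
  gen_choiceMixin (lie_term K n).

Section KacMoodyAlgebra.
Variables (K : fieldType) (n : nat) (A : 'M[int]_n).
Local Open Scope quotient_scope.

Definition km_eqb (t u : lie_term K n) : bool := `[< km_eq A t u >].

Lemma km_eqb_equiv : equiv_class_of km_eqb.
Proof.
split=> [t|t u|t u v]; first by apply/asboolP; apply: km_refl.
  by apply/asboolP/asboolP; apply: km_sym.
by move=> /asboolP tu /asboolP uv; apply/asboolP; apply: km_trans uv.
Qed.

Canonical km_eqb_equiv_rel := EquivRelPack km_eqb_equiv.

Definition km_alg := {eq_quot km_eqb}.
HB.instance Definition _ := Choice.on km_alg.

Definition km_class (t : lie_term K n) : km_alg := \pi t.

Lemma km_classP t u : km_class t = km_class u <-> km_eq A t u.
Proof.
split=> [/eqP|tu]; first by rewrite eqmodE => /asboolP.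
by apply/eqP; rewrite eqmodE; apply/asboolP.
Qed.

Lemma km_alg_ind (P : km_alg -> Prop) :
  (forall t, P (km_class t)) -> forall a, P a.
Proof. by move=> Pt a; rewrite -[a]reprK; apply: Pt. Qed.

Definition km_add (a b : km_alg) := km_class (LAdd (repr a) (repr b)).
Definition km_opp (a : km_alg) := km_class (LOpp (repr a)).
Definition km_scale c (a : km_alg) := km_class (LScale c (repr a)).
Definition km_br (a b : km_alg) := km_class (LBr (repr a) (repr b)).

Lemma repr_km_class t : km_eq A (repr (km_class t)) t.
Proof. by apply/km_classP; rewrite /km_class reprK. Qed.

Lemma km_class_add t u : km_class (LAdd t u) = km_add (km_class t) (km_class u).
Proof.
by apply/km_classP/km_sym/km_congD; apply: repr_km_class.
Qed.

Lemma km_class_opp t : km_class (LOpp t) = km_opp (km_class t).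
Proof. by apply/km_classP/km_sym/km_congN; apply: repr_km_class. Qed.

Lemma km_class_scale c t : km_class (LScale c t) = km_scale c (km_class t).
Proof. by apply/km_classP/km_sym/km_congZ; apply: repr_km_class. Qed.

Lemma km_class_br t u : km_class (LBr t u) = km_br (km_class t) (km_class u).
Proof. by apply/km_classP/km_sym/km_congB; apply: repr_km_class. Qed.

Definition km_classE :=
  (km_class_add, km_class_opp, km_class_scale, km_class_br).

Lemma km_alg_addA : associative km_add.
Proof.
elim/km_alg_ind=> t; elim/km_alg_ind=> u; elim/km_alg_ind=> v.
by rewrite -!km_classE; apply/km_classP/km_addA.
Qed.

Lemma km_alg_addC : commutative km_add.
Proof.
elim/km_alg_ind=> t; elim/km_alg_ind=> u.
by rewrite -!km_classE; apply/km_classP/km_addC.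
Qed.

Lemma km_alg_add0 : left_id (km_class LZero) km_add.
Proof.
by elim/km_alg_ind=> t; rewrite -!km_classE; apply/km_classP/km_add0.
Qed.

Lemma km_alg_addN : left_inverse (km_class LZero) km_opp km_add.
Proof.
by elim/km_alg_ind=> t; rewrite -!km_classE; apply/km_classP/km_addN.
Qed.

HB.instance Definition _ :=
  GRing.isZmodule.Build km_alg km_alg_addA km_alg_addC km_alg_add0 km_alg_addN.

Lemma km_alg_scaleA c d a : km_scale c (km_scale d a) = km_scale (c * d) a.
Proof.
by elim/km_alg_ind: a => t; rewrite -!km_classE; apply/km_classP/km_scaleA.
Qed.

Lemma km_alg_scale1 : left_id 1 km_scale.
Proof.
by elim/km_alg_ind=> t; rewrite -!km_classE; apply/km_classP/km_scale1.
Qed.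

Lemma km_alg_scaleDr : right_distributive km_scale +%R.
Proof.
move=> c; elim/km_alg_ind=> t; elim/km_alg_ind=> u.
rewrite -![_ + _]/(km_add _ _) -!km_classE.
exact/km_classP/km_scaleDr.
Qed.

Lemma km_alg_scaleDl a : {morph km_scale^~ a : c d / c + d}.
Proof.
move=> c d; elim/km_alg_ind: a => t.
rewrite -[RHS]/(km_add _ _) -!km_classE.
exact/km_classP/km_scaleDl.
Qed.

HB.instance Definition _ := GRing.Zmodule_isLmodule.Build K km_alg
  km_alg_scaleA km_alg_scale1 km_alg_scaleDr km_alg_scaleDl.

Lemma km_br_is_linear a : linear (km_br a).
Proof.
move=> c; elim/km_alg_ind: a => t; elim/km_alg_ind=> u; elim/km_alg_ind=> v.
rewrite -[LHS]/(km_br _ (km_add (km_scale _ _) _)).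
rewrite -[RHS]/(km_add (km_scale _ _) _) -!km_classE.
apply/km_classP; apply: km_trans (km_brDr _ _ _ _) _.
by apply: km_congD; [apply: km_brZr|apply: km_refl].
Qed.

HB.instance Definition _ a :=
  GRing.isLinear.Build K km_alg km_alg _ (km_br a) (km_br_is_linear a).

Lemma km_br_addl a b c : km_br (a + b) c = km_br a c + km_br b c.
Proof.
elim/km_alg_ind: a => t; elim/km_alg_ind: b => u; elim/km_alg_ind: c => v.
rewrite -![_ + _]/(km_add _ _) -!km_classE.
exact/km_classP/km_brDl.
Qed.

Lemma km_br_self a : km_br a a = 0.
Proof.
by elim/km_alg_ind: a => t; rewrite -!km_classE; apply/km_classP/km_brxx.
Qed.

Lemma km_br_anti a b : km_br a b = - km_br b a.
Proof.
apply/eqP; rewrite -addr_eq0; have := km_br_self (a + b).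
by rewrite km_br_addl !linearD /= !km_br_self add0r addr0 => ->.
Qed.

Lemma km_br_scalel k a b : km_br (k *: a) b = k *: km_br a b.
Proof. by rewrite km_br_anti linearZ /= -scalerN -km_br_anti. Qed.

Lemma km_br_oppl a b : km_br (- a) b = - km_br a b.
Proof. by rewrite -scaleN1r km_br_scalel scaleN1r. Qed.

Lemma km_br_zerol a : km_br 0 a = 0.
Proof. by rewrite -[X in km_br X](subrr 0) km_br_addl km_br_oppl subrr. Qed.

Lemma km_br_leibniz a b c :
  km_br a (km_br b c) = km_br (km_br a b) c + km_br b (km_br a c).
Proof.
have : km_br a (km_br b c) + (km_br b (km_br c a) + km_br c (km_br a b)) = 0.
  elim/km_alg_ind: a => t; elim/km_alg_ind: b => u; elim/km_alg_ind: c => v.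
  rewrite -![_ + _]/(km_add _ _) -!km_classE.
  exact/km_classP/km_jacobi.
move/eqP; rewrite addr_eq0 => /eqP ->.
by rewrite opprD (km_br_anti c a) linearN opprK (km_br_anti c) opprK addrC.
Qed.

Definition km_e i := km_class (LE i).
Definition km_f i := km_class (LF i).
Definition km_h i := km_class (LH i).

Lemma km_br_ef i j : km_br (km_e i) (km_f j) = if i == j then km_h i else 0.
Proof.
rewrite -km_class_br; have /km_classP -> := km_ef K A i j.
by case: eqP.
Qed.

Lemma km_br_he i j : km_br (km_h i) (km_e j) = (A i j)%:~R *: km_e j.
Proof.
rewrite -km_class_br; have /km_classP -> := km_he K A i j.
exact: km_class_scale.
Qed.

Lemma km_br_hf i j : km_br (km_h i) (km_f j) = - (A i j)%:~R *: km_f j.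
Proof.
rewrite -km_class_br; have /km_classP -> := km_hf K A i j.
exact: km_class_scale.
Qed.

Lemma km_br_serre_f i j : i != j ->
  iter `|1 - A i j|%N (km_br (km_f i)) (km_f j) = 0.
Proof.
move=> /(km_serre_f K A)/km_classP serre; rewrite -[RHS]serre {serre}.
by elim: `|_|%N => //= q ->; rewrite km_class_br.
Qed.

(** Each use of the Leibniz rule spends one [d] on one of the two factors, so induction on [k]
    avoids binomial coefficients. *)
Lemma iter_br_leibniz k N M d a b : (N + M <= k)%N ->
  iter N (km_br d) a = 0 -> iter M (km_br d) b = 0 ->
  iter k (km_br d) (km_br a b) = 0.
Proof.
have iter0 q : iter q (km_br d) 0 = 0 by elim: q => //= q ->; rewrite linear0.
elim: k N M a b => [|k IHk] [|N] [|M] a b // leNMk aN bM.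
- by rewrite [a]aN km_br_zerol.
- by rewrite [a]aN km_br_zerol iter0.
- by rewrite [a]aN km_br_zerol iter0.
- by rewrite [b]bM linear0 iter0.
have iterD q x y :
    iter q (km_br d) (x + y) = iter q (km_br d) x + iter q (km_br d) y.
  by elim: q => //= q ->; rewrite linearD.
rewrite iterSr km_br_leibniz iterD.
rewrite iterSr in aN; rewrite (IHk N M.+1) ?add0r //.
by rewrite iterSr in bM; apply: (IHk N.+1 M); rewrite ?iterSr // addSnnS.
Qed.

(** Induction on a term representing [a]: the Serre relations settle the generators f_j, and the
    Leibniz rule settles brackets. *)
Lemma km_f_locally_nilpotent i a : exists N, iter N (km_br (km_f i)) a = 0.
Proof.
have iter0 q : iter q (km_br (km_f i)) 0 = 0.
  by elim: q => //= q ->; rewrite linear0.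
have iter_add q x y : iter q (km_br (km_f i)) (x + y) =
    iter q (km_br (km_f i)) x + iter q (km_br (km_f i)) y.
  by elim: q => //= q ->; rewrite linearD.
have iterZ q c x : iter q (km_br (km_f i)) (c *: x) =
    c *: iter q (km_br (km_f i)) x.
  by elim: q => //= q ->; rewrite linearZ.
have hf j : iter 2 (km_br (km_f i)) (km_h j) = 0.
  rewrite iterSr km_br_anti km_br_hf scaleNr opprK iterZ /=.
  by rewrite km_br_self scaler0.
elim/km_alg_ind: a.
elim=> [|t [N tN] u [M uM]|t [N tN]|c t [N tN]|t [N tN] u [M uM]|j|j|j].
- by exists 0.
- exists (N + M)%N; rewrite km_class_add.
  rewrite -[km_add _ _]/(km_class t + km_class u) iter_add addnC iterD tN iter0.
  by rewrite addnC iterD uM iter0 addr0.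
- exists N; rewrite km_class_opp -[km_opp _]/(- km_class t) -scaleN1r.
  by rewrite iterZ tN scaler0.
- exists N; rewrite km_class_scale -[km_scale _ _]/(c *: km_class t).
  by rewrite iterZ tN scaler0.
- by exists (N + M)%N; rewrite km_class_br; apply: iter_br_leibniz tN uM.
(* One step leads from e_j to a multiple of h_j, and two more kill it. *)
- exists 3; rewrite iterSr km_br_anti -/(km_e j) km_br_ef -scaleN1r iterZ.
  by case: eqP => _; rewrite ?hf ?iter0 scaler0.
- have [<-|/km_br_serre_f] := eqVneq i j; first by exists 1; apply: km_br_self.
  by exists `|1 - A i j|%N.
- by exists 2; apply: hf.
Qed.

End KacMoodyAlgebra.

(** * Root strings *)

Section RootStrings.
Variables (K : fieldType) (charK : [pchar K] =i pred0).
Variables (n : nat) (A : 'M[int]_n).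
Hypothesis A_diag : forall i, A i i = 2.
Hypothesis A_off : forall i j, i != j -> A i j <= 0.
Hypothesis A_zero : forall i j, A i j = 0 -> A j i = 0.

Definition km_weight (c : 'I_n -> int) : Prop :=
  exists2 x : km_alg K A, x <> 0 &
    forall i, km_br (km_h K A i) x = (\sum_j c j * A i j)%:~R *: x.

Lemma km_weight_root c : (exists j, c j != 0) -> km_weight c -> km_root K A c.
Proof.
move=> c0 [x x0 hx]; split=> //; elim/km_alg_ind: x x0 hx => t t0 ht.
exists t; split=> [|i]; first by move/km_classP.
by apply/km_classP; rewrite km_class_br km_class_scale; apply: ht.
Qed.

Lemma km_weight_ext c d : c =1 d -> km_weight c -> km_weight d.
Proof.
move=> cd [x x0 hx]; exists x => // i; rewrite hx.
by congr (_%:~R *: _); apply: eq_bigr => j _; rewrite cd.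
Qed.

Lemma sum_delta_mul i (F : 'I_n -> int) : \sum_j (j == i)%:Z * F j = F i.
Proof.
rewrite (bigD1 i) //= eqxx mul1r big1 ?addr0 // => j /negPf ->.
by rewrite mul0r.
Qed.

(** If e_k were zero, so would be h_k = [e_k, f_k]; but h_k fixes the vacuum of the lowest weight
    module. *)
Lemma km_weight_simple k : km_weight (fun j => (j == k)%:Z).
Proof.
exists (km_e K A k) => [e0|i]; last by rewrite sum_delta_mul km_br_he.
have : km_h K A k = 0 by have := km_br_ef K A k k; rewrite eqxx e0 km_br_zerol.
move/km_classP/(action_km_eq A_diag A_off A_zero)/(_ (generated_vacuum K A)).
rewrite /= cartan_vacuum => /(congr1 (@^~ [::])) /eqP.
by rewrite [_ == _]oner_eq0.
Qed.

(** If (ad e_i)^k kills [x], so does (ad e_i)^m, where m >= k is minus the pairing of [c] with the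
    coroot; this forces [x = 0]. The case k = m is the simple reflection of [c]. *)
Lemma km_weight_string c i (k : nat) :
  k%:Z <= - \sum_j c j * A i j -> km_weight c ->
  km_weight (fun j => c j + k%:Z * (j == i)%:Z).
Proof.
move=> kle [x x0 hx]; set p := \sum_j _ in kle.
have [N fN] := km_f_locally_nilpotent i x.
have fe : km_br (km_f K A i) (km_e K A i) = - km_h K A i.
  by rewrite km_br_anti km_br_ef eqxx.
have he j : km_br (km_h K A j) (km_e K A i) = (A j i)%:~R *: km_e K A i.
  exact: km_br_he.
exists (iter k (km_br (km_e K A i)) x) => [ek0|l]; last first.
  have -> : \sum_j (c j + k%:Z * (j == i)%:Z) * A l j =
            \sum_j c j * A l j + k%:Z * A l i.
    under eq_bigr => j _ do rewrite mulrDl -mulrA.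
    by rewrite big_split -mulr_sumr sum_delta_mul.
  elim: k {kle} => [|k IHk] /=; first by rewrite mul0r addr0.
  rewrite km_br_leibniz he IHk km_br_scalel linearZ /= -scalerDl -rmorphD /=.
  by congr (_%:~R *: _); lia.
apply: x0; have [m pm] : exists m : nat, - p = m%:Z by exists `|p|%N; lia.
(* In the sl2-triple used here [ad f_i] raises and [ad e_i] lowers; with respect to -h_i the vector
   [x] has weight m. *)
apply: (@sl2_lower_injective K charK (km_alg K A) (km_br (km_f K A i))
  (km_br (km_e K A i)) (km_br (- km_h K A i)) _ _ _ N m x) => //.
- by move=> v /=; rewrite km_br_leibniz fe addrC.
- move=> v /=; rewrite km_br_leibniz km_br_oppl km_br_hf A_diag scaleNr opprK.
  by rewrite addrC km_br_scalel.
- move=> v /=; rewrite km_br_leibniz km_br_oppl he A_diag km_br_oppl addrC.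
  by rewrite km_br_scalel.
- by rewrite /= km_br_oppl hx -/p -scaleNr -rmorphN pm.
have /subnK <- : (k <= m)%N by lia.
rewrite iterD ek0; elim: (m - k)%N => //= q ->; exact: linear0.
Qed.

End RootStrings.

(** * Roots of E10 *)

(** The data of E10 are copied to natural number indices, where [vm_compute] can evaluate them. *)
Definition cartan_entry (i j : nat) : int :=
  let e a b := ((b == a.+1) && (b < 9)%N) || ((a == 6) && (b == 9)) in
  if i == j then 2 else if e i j || e j i then -1 else 0.

Lemma e10_cartanE (i j : 'I_10) : e10_cartan i j = cartan_entry i j.
Proof. by rewrite mxE /cartan_entry /e10_edge -val_eqE. Qed.

Definition simple_coord (j k : nat) : int :=
  if (j < 9)%N then (k == j)%:R - (k == j.+1)%:R
  else (k == 7)%:R + (k == 8)%:R + (k == 9)%:R.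

Lemma simple_rootE (j k : 'I_10) : simple_root j 0 k = simple_coord j k.
Proof.
rewrite /simple_root /simple_coord; case: ifP => j9;
  by rewrite !mxE -!val_eqE /= !inordK ?ltnS.
Qed.

Definition sum10 (f : nat -> int) : int :=
  foldr (fun k x => f k + x) 0 (iota 0 10).

Lemma sum10E (f : nat -> int) : \sum_(k < 10) f k = sum10 f.
Proof. by rewrite -(big_mkord xpredT) unlock. Qed.

Lemma forall_ord10 (P : pred nat) : all P (iota 0 10) -> forall i : 'I_10, P i.
Proof. by move/allP => Pi i; apply: Pi; rewrite mem_iota /= ltn_ord. Qed.

(* A string [:: (i_r, k_r); ...; (i_1, k_1); (i_0, 1)] stands for the Lie word
   (ad e_{i_r})^{k_r} ... (ad e_{i_1})^{k_1} e_{i_0}. *)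
Definition word_weight (s : seq (nat * nat)) (j : nat) : int :=
  sumn [seq (b.2 * (j == b.1))%N | b <- s].

(** The inequality is the bound of [km_weight_string], so a word that passes is nonzero in the
    algebra. *)
Fixpoint good_word (s : seq (nat * nat)) : bool :=
  match s with
  | [::] => false
  | [:: b] => (b.1 < 10)%N && (b.2 == 1)
  | b :: s' => [&& (b.1 < 10)%N,
      b.2%:Z <= - sum10 (fun j => word_weight s' j * cartan_entry b.1 j)
      & good_word s']
  end.

Lemma good_word_weight (K : fieldType) (s : seq (nat * nat)) :
  [pchar K] =i pred0 -> good_word s ->
  km_weight K e10_cartan (fun j : 'I_10 => word_weight s j).
Proof.
move=> charK.
have A_diag i : e10_cartan i i = 2 by rewrite mxE eqxx.
have A_off i j : i != j -> e10_cartan i j <= 0.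
  by rewrite mxE => /negPf ->; case: ifP.
have A_zero i j : e10_cartan i j = 0 -> e10_cartan j i = 0.
  by rewrite !mxE eq_sym orbC.
elim: s => [|[i k] [|b s] IHs] //.
  move=> /andP[/= i10 /eqP ->].
  apply: km_weight_ext (km_weight_simple K A_diag A_off A_zero (Ordinal i10)).
  by move=> j; rewrite /word_weight /= mul1n addn0 -val_eqE.
move=> /and3P[/= i10 kle /IHs sW].
apply: km_weight_ext (km_weight_string (i := Ordinal i10) (k := k)
  charK A_diag _ sW).
  by move=> j; rewrite -val_eqE /word_weight /= addrC -PoszM -PoszD.
under eq_bigr => j _ do rewrite e10_cartanE.
by rewrite (sum10E (fun j => word_weight (b :: s) j * cartan_entry i j)).
Qed.

Definition root_check (s : seq (nat * nat)) (l : seq int) : bool :=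
  [&& good_word s, has (fun j => word_weight s j != 0) (iota 0 10) &
    all (fun k => nth 0 l k ==
      sum10 (fun j => word_weight s j * simple_coord j k)) (iota 0 10)].

Lemma root_check_positive (K : fieldType) (s : seq (nat * nat)) (l : seq int) :
  [pchar K] =i pred0 -> root_check s l -> e10_positive_root K (vec10 l).
Proof.
move=> charK /and3P[sW s0 sl]; exists (fun j : 'I_10 => word_weight s j).
  apply/rowP => k; rewrite mxE summxE.
  under eq_bigr => j _ do rewrite mxE simple_rootE.
  rewrite (sum10E (fun j => word_weight s j * simple_coord j k)).
  exact/eqP/(forall_ord10 sl).
split=> //; apply: km_weight_root; last exact: good_word_weight.
have /hasP[j] := s0; rewrite mem_iota => /andP[_ j10] sj.
by exists (Ordinal j10).
Qed.

(* Prefixed to null_word, each of the words below lists simple reflections from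
   the null root of E9 to tau, the last one first. *)
Definition null_word : seq nat :=
  [:: 1; 2; 3; 4; 5; 6; 7; 8; 9; 6; 5; 4; 3; 2; 7; 6; 5; 4; 3; 9; 6; 5; 4;
      7; 6; 5; 8; 7; 6; 9]%N.

Definition T5_word : seq nat :=
  [:: 4; 3; 2; 1; 0; 5; 4; 3; 2; 1; 6; 5; 4; 3; 2; 7; 6; 5; 4; 3; 8; 7; 6;
      5; 4; 9; 6; 5; 7; 6; 8; 7; 9; 6; 5; 4; 3; 2; 1; 0]%N.

Definition T8_word : seq nat :=
  [:: 1; 0; 2; 1; 3; 2; 4; 3; 5; 4; 6; 5; 7; 6; 8; 7; 9; 6; 5; 4; 3; 2; 1;
      0]%N.

Definition IA_word : seq nat :=
  [:: 7; 6; 5; 4; 3; 2; 1; 0; 9; 6; 5; 4; 3; 2; 1; 7; 6; 5; 4; 3; 2; 9; 6;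
      5; 4; 3; 7; 6; 5; 4; 9; 6; 5; 7; 6; 8; 7; 9; 6; 5; 4; 3; 2; 1; 0]%N.

Definition T4_word : seq nat :=
  [:: 5; 4; 3; 2; 1; 0; 6; 5; 4; 3; 2; 1; 7; 6; 5; 4; 3; 2; 9; 6; 5; 4; 3;
      7; 6; 5; 4; 9; 6; 5; 7; 6; 8; 7; 9; 6; 5; 4; 3; 2; 1; 0]%N.

Definition simple_steps (s : seq nat) : seq (nat * nat) :=
  [seq (i, 1%N) | i <- s].


Lemma perm_1113 (l : seq int) : perm_eq l [:: 1; 1; 1; 3] ->
  l \in [:: [:: 1; 1; 1; 3]; [:: 1; 1; 3; 1]; [:: 1; 3; 1; 1]; [:: 3; 1; 1; 1]].
Proof.
rewrite -mem_permutations.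
suff -> : permutations [:: 1; 1; 1; 3] = [:: [:: 1; 1; 1; 3]; [:: 1; 1; 3; 1];
  [:: 1; 3; 1; 1]; [:: 3; 1; 1; 1]] :> seq (seq int) by [].
by vm_compute.
Qed.

Lemma orbifold_data_positive (K : fieldType) T s tau :
  [pchar K] =i pred0 -> orbifold_data T s tau -> e10_positive_root K tau.
Proof.
move=> charK [||||l /perm_1113].
- by apply: (root_check_positive (s := simple_steps (T5_word ++ null_word)))
    charK _; vm_compute.
- by apply: (root_check_positive (s := simple_steps (T8_word ++ null_word)))
    charK _; vm_compute.
- by apply: (root_check_positive (s := simple_steps (IA_word ++ null_word)))
    charK _; vm_compute.
(* Here [tau] is the null root of E9 itself. *)
- by apply: (root_check_positive (s := simple_steps null_word)) charK _;
    vm_compute.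
pose w := simple_steps (T4_word ++ null_word).
rewrite !inE => /or4P[] /eqP ->.
- by apply: (root_check_positive (s := w)) charK _; vm_compute.
(* Reflecting in epsilon_9 - epsilon_10 swaps the entries 1 and 3, whose difference is the exponent
   2. The next two cases move the 3 further left in the same way. *)
- by apply: (root_check_positive (s := (8, 2)%N :: w)) charK _; vm_compute.
- by apply: (root_check_positive (s := [:: (7, 2), (8, 2) & w]%N)) charK _;
    vm_compute.
- by apply: (root_check_positive (s := [:: (6, 2), (7, 2), (8, 2) & w]%N))
    charK _; vm_compute.
Qed.

(** * Charges *)

Lemma coord_sum_is_zmod_morphism : zmod_morphism coord_sum.
Proof.
move=> a b; rewrite /coord_sum -sumrB.
by apply: eq_bigr => i _; rewrite !mxE.
Qed.

HB.instance Definition _ := GRing.isZmodMorphism.Build 'rV[int]_10 int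
  coord_sum coord_sum_is_zmod_morphism.

Lemma coord_sum_eps i : coord_sum (eps i) = 1.
Proof.
rewrite /coord_sum (bigD1 i) //= mxE !eqxx big1 // => j /negPf ji.
by rewrite mxE ji.
Qed.

Lemma e10_latticeD a b :
  a \in e10_lattice -> b \in e10_lattice -> a + b \in e10_lattice.
Proof. by rewrite !inE raddfD; apply: rpredD. Qed.

Lemma e10_latticeN a : a \in e10_lattice -> - a \in e10_lattice.
Proof. by rewrite !inE raddfN rpredN. Qed.

Lemma e10_lattice0 : 0 \in e10_lattice.
Proof. by rewrite inE raddf0 dvdz0. Qed.

Lemma eps_sub_lattice i j : eps i - eps j \in e10_lattice.
Proof. by rewrite inE raddfB /= !coord_sum_eps. Qed.

Lemma eps_add3_lattice i j l : eps i + eps j + eps l \in e10_lattice.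
Proof. by rewrite inE !raddfD /= !coord_sum_eps. Qed.

Lemma simple_root_lattice j : simple_root j \in e10_lattice.
Proof.
by rewrite /simple_root; case: ifP => _;
  [apply: eps_sub_lattice|apply: eps_add3_lattice].
Qed.

(** * Uniqueness of the multiplicative extension *)

Section Extension.
Variables (T : {set 'I_10}) (s : int) (q : 'rV[int]_10 -> int).
Hypothesis ext_q : multiplicative_extension T s q.

Lemma ext_0 : q 0 = 1.
Proof.
have := ext_mul ext_q e10_lattice0 e10_lattice0; rewrite addr0.
by case: (ext_sign ext_q e10_lattice0) => ->.
Qed.

Lemma ext_opp a : a \in e10_lattice -> q (- a) = q a.
Proof.
move=> aQ; have := ext_mul ext_q aQ (e10_latticeN aQ); rewrite subrr ext_0.
case: (ext_sign ext_q aQ) => ->;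
  by case: (ext_sign ext_q (e10_latticeN aQ)) => ->.
Qed.

End Extension.

(** The prescribed values include those at the simple roots, and agreement passes to sums and
    opposites. Lattice membership is carried along because multiplicativity is assumed only
    there. *)
Lemma ext_unique T s q q' beta :
  multiplicative_extension T s q -> multiplicative_extension T s q' ->
  (exists c : 'I_10 -> int, beta = \sum_j c j *: simple_root j) ->
  beta \in e10_lattice /\ q beta = q' beta.
Proof.
move=> xq xq' [c ->]; pose P a := a \in e10_lattice /\ q a = q' a.
have P0 : P 0.
  by split; [exact: e10_lattice0|rewrite !(ext_0 (T := T) (s := s))].
have PD a b : P a -> P b -> P (a + b).
  move=> [aQ qa] [bQ qb]; split; first exact: e10_latticeD.
  by rewrite (ext_mul xq) // (ext_mul xq') // qa qb.
have PN a : P a -> P (- a).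
  move=> [aQ qa]; split; first exact: e10_latticeN.
  by rewrite (ext_opp xq) // (ext_opp xq').
have PS j : P (simple_root j).
  split; first exact: simple_root_lattice.
  rewrite /simple_root; case: ifP => j9; last first.
    by rewrite (ext_form xq) ?(ext_form xq') // !inordK.
  have neq_j : j != inord j.+1 by rewrite -val_eqE /= inordK ?ltn_eqF.
  by rewrite (ext_metric xq) // (ext_metric xq').
have PX a k : P a -> P (a *+ k).
  by move=> Pa; elim: k => [|k Pk]; rewrite ?mulr0n // mulrS; apply: PD.
apply: (@big_ind _ P) => // j _; rewrite -[c j]intz scaler_int.
by case: (c j) => k; rewrite ?NegzE ?mulrNz; [|apply: PN]; apply: PX.
Qed.

(** * The charge defined by pairing with tau *)

Section Charge.
Variables (T : {set 'I_10}) (s : int) (tau : 'rV[int]_10) (m : int).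
Hypothesis tau_sum : coord_sum tau = 3 * m.
Hypothesis tau_parity : forall i, odd `|tau 0 i| = (i \in T).
Hypothesis s_parity : s = (-1) ^ m.

(** The form as an integer: when both coordinate sums are divisible by 3, the factor 1/9 is absorbed
    by their thirds. *)
Definition e10_pairing (a : 'rV[int]_10) : int :=
  \sum_i a 0 i * tau 0 i - (coord_sum a %/ 3)%Z * m.

Definition charge (a : 'rV[int]_10) : int := (-1) ^ e10_pairing a.

Lemma e10_formE a : a \in e10_lattice -> e10_form a tau = (e10_pairing a)%:~R.
Proof.
rewrite inE => /divzK aQ; rewrite /e10_form /e10_pairing tau_sum -{1}aQ.
by rewrite rmorphB /= !rmorphM /=; field.
Qed.

Lemma e10_pairingD a b : a \in e10_lattice ->
  e10_pairing (a + b) = e10_pairing a + e10_pairing b.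
Proof.
rewrite inE => aQ; rewrite /e10_pairing raddfD /= divzDl // mulrDl opprD.
under eq_bigr => i _ do rewrite mxE mulrDl.
by rewrite big_split /= addrACA.
Qed.

Lemma sum_eps_mul i : \sum_j eps i 0 j * tau 0 j = tau 0 i.
Proof.
rewrite (bigD1 i) //= mxE !eqxx mul1r big1 ?addr0 // => j /negPf ji.
by rewrite mxE ji mul0r.
Qed.

Lemma signD (a b : int) : (-1) ^ (a + b) = (-1) ^ a * (-1) ^ b :> int.
Proof. by rewrite exprzDr ?unitrN1. Qed.

Lemma signN (a : int) : (-1) ^ (- a) = (-1) ^ a :> int.
Proof. by rewrite !expN1r abszN. Qed.

Lemma sign_tau i : (-1) ^ (tau 0%R i) = (-1) ^+ (i \in T) :> int.
Proof. by rewrite expN1r -signr_odd tau_parity. Qed.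

Lemma sign_cardI (A : {set 'I_10}) :
  (-1) ^+ #|A :&: T| = \prod_(i in A) (-1) ^+ (i \in T) :> int.
Proof.
rewrite prodrXr -sum1_card; congr (_ ^+ _).
rewrite (eq_bigl (fun i => (i \in A) && (i \in T))); last first.
  by move=> i; rewrite inE.
by rewrite big_mkcondr; apply: eq_bigr => i _; case: (i \in T).
Qed.

(** The pairings with tau are tau_I - tau_J and tau_I + tau_J + tau_L - m. Modulo 2 the coordinates
    count membership in [T], and m accounts for [s]. *)
Lemma charge_extension : multiplicative_extension T s charge.
Proof.
split=> [a aQ|a b aQ bQ|I J neq_IJ|I J L ltIJ ltJL].
- rewrite /charge expN1r -signr_odd.
  by case: (odd _); [right|left].
- by rewrite /charge e10_pairingD // signD.
- rewrite sign_cardI big_setU1 ?inE // big_set1 /charge /e10_pairing.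
  rewrite raddfB /= !coord_sum_eps subrr div0z mul0r subr0.
  under eq_bigr => i _ do rewrite mxE [X in _ + X]mxE mulrDl mulNr.
  by rewrite sumrB !sum_eps_mul signD signN !sign_tau.
- have neq_IJ : I != J by rewrite -val_eqE ltn_eqF.
  have neq_JL : J != L by rewrite -val_eqE ltn_eqF.
  have neq_IL : I != L by rewrite -val_eqE ltn_eqF // (ltn_trans ltIJ).
  have -> : [set I; J; L] = I |: [set J; L] by rewrite -setUA.
  rewrite sign_cardI !big_setU1 ?inE ?negb_or ?neq_IJ ?neq_IL // big_set1.
  rewrite /charge /e10_pairing !raddfD /= !coord_sum_eps divzz /= mul1r.
  under eq_bigr => i _ do rewrite mxE [X in X + _]mxE !mulrDl.
  rewrite !big_split /= !sum_eps_mul !signD signN !sign_tau s_parity.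
  by rewrite mulrC mulrA.
Qed.

End Charge.

(** The last test expresses isotropy: for coordinate sum 3 m, the correction term in (tau|tau) is
    m^2. *)
Definition charge_check (d : seq nat) (s : int) (l : seq int) (m : int) :
    bool :=
  [&& all (fun i => odd `|l`_i| == (i.+1 \in d)) (iota 0 10),
    sum10 (nth 0 l) == 3 * m, s == (-1) ^ m &
    sum10 (fun i => l`_i * l`_i) == m * m].

Lemma orbifold_data_charge T s tau : orbifold_data T s tau ->
  exists m, [/\ coord_sum tau = 3 * m, forall i, odd `|tau 0 i| = (i \in T),
    s = (-1) ^ m & \sum_i tau 0 i * tau 0 i = m * m].
Proof.
have check d s' l m : charge_check d s' l m -> let tau' := vec10 l in
    exists m, [/\ coord_sum tau' = 3 * m,
      forall i, odd `|tau' 0 i| = (i \in directions d),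
      s' = (-1) ^ m & \sum_i tau' 0 i * tau' 0 i = m * m].
  move=> /and4P[dP /eqP sumP /eqP sP /eqP normP]; exists m; split=> //.
  - rewrite /coord_sum; under eq_bigr => i _ do rewrite mxE.
    by rewrite sum10E.
  - move=> i; rewrite mxE inE; exact/eqP/(forall_ord10 dP).
  - under eq_bigr => i _ do rewrite mxE.
    by rewrite (sum10E (fun i => l`_i * l`_i)).
case=> [||||l /perm_1113].
(* The witnesses 5, 4, 7, 3 and 6 are the thirds of the coordinate sums. *)
- by apply: (check _ _ _ 5); vm_compute.
- by apply: (check _ _ _ 4); vm_compute.
- by apply: (check _ _ _ 7); vm_compute.
- by apply: (check _ _ _ 3); vm_compute.
by rewrite !inE => /or4P[] /eqP ->; apply: (check _ _ _ 6); vm_compute.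
Qed.

Theorem mainTheorem1 (K : fieldType) (charK : [pchar K] =i pred0)
    (T : {set 'I_10}) (s : int) (tau : 'rV[int]_10)
    (data : orbifold_data T s tau) :
  [/\ e10_positive_root K tau,
      e10_form tau tau = 0,
      exists q, multiplicative_extension T s q &
      forall q, multiplicative_extension T s q ->
      forall beta, e10_root K beta ->
      exists2 k : int, e10_form beta tau = k%:~R & q beta = (-1) ^ k].
Proof.
have [m [tau_sum tau_parity s_parity tau_norm]] := orbifold_data_charge data.
have chargeP := charge_extension tau_parity s_parity.
split; first exact: orbifold_data_positive data.
- rewrite (e10_formE tau_sum) ?inE ?tau_sum ?dvdz_mulr //.
  by rewrite /e10_pairing tau_norm tau_sum mulKz // subrr.
- by exists (charge tau m).
move=> q qP beta [c betaE _].
(* A root is an integer combination of simple roots, so [q] may be replaced by [charge] at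
   [beta]. *)
have [betaQ ->] := ext_unique qP chargeP (ex_intro _ c betaE).
by exists (e10_pairing tau m beta); rewrite ?(e10_formE tau_sum).
Qed.
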